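(* Let $N\ge2$ and $A\in M_N(\{0,1\})$. For $(J,c)\in\{1,\ldots,N\}^*_{A,c}\times U(1)$ and $p\ge1$, $$P(J^p;c)\sim\bigoplus_{j=1}^pP(J;c^{1/p}\xi^j),$$ where $\xi=e^{2\pi\sqrt{-1}/p}$. Especially, $P(J^p)\sim\bigoplus_{j=1}^pP(J;\xi^j)$.
   Context: $U(1)=\{z\in{\bf C}:|z|=1\}$ and $c^{1/p}$ is a $p$-th root of $c$. $M_N(\{0,1\})$ is the set of $N\times N$ matrices with entries in $\{0,1\}$ having no row or column identically equal to zero. For $A=(a_{ij})\in M_N(\{0,1\})$, the Cuntz-Krieger algebra ${\cal O}_A$ is the $C^*$-algebra universally generated by partial isometries $s_1,\ldots,s_N$ satisfying $s_i^*s_i=\sum_{j=1}^N a_{ij}s_js_j^*$ for $i=1,\ldots,N$ and $\sum_{i=1}^N s_is_i^*=I$. A representation is a unital $*$-representation on a complex Hilbert space; $\sim$ denotes unitary equivalence. $\{1,\ldots,N\}^*_{A,c}$ (the subscript $c$ is part of the notation, standing for ''cyclic'') is the set of finite words $(j_1,\ldots,j_k)$, $k\ge1$, in $\{1,\ldots,N\}$ with $a_{j_{i-1}j_i}=1$ for $i=2,\ldots,k$ and $a_{j_kj_1}=1$. $J^p$ is the $p$-fold concatenation of $J$. For a finite word $J=(j_l)_{l=1}^k$ and $z\in U(1)$, a representation $({\cal H},\pi)$ of ${\cal O}_A$ is $P(J;z)$ if there is a cyclic unit vector $\Omega\in{\cal H}$ such that $\pi(s_{j_1}\cdots s_{j_k})\Omega=z\Omega$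 and $\{\pi(s_{j_l}\cdots s_{j_k})\Omega\}_{l=1}^k$ is an orthonormal family; $P(J)=P(J;1)$. For $J\in\{1,\ldots,N\}^*_{A,c}$ such a representation exists and is unique up to unitary equivalence, and the symbols $P(J;z)$, $P(J)$ also denote this equivalence class. *)

(* Defs.v *)
From HB Require Import structures.
From mathcomp Require Import all_boot all_order all_algebra.
From mathcomp Require Import sesquilinear complex ring.
From mathcomp Require Import mathcomp_extra boolp classical_sets functions reals.
From mathcomp Require Import topology normedtype trigo.

Set Implicit Arguments.
Unset Strict Implicit.
Unset Printing Implicit Defensive.

Import Order.TTheory GRing.Theory Num.Theory.
Import numFieldNormedType.Exports.

Local Open Scope classical_set_scope.
Local Open Scope ring_scope.

(* Inner products are linear in the first argument and conjugate-linear in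
   the second one. *)
HB.mixin Record NormedModule_isPreHilbert (C : numClosedFieldType) V
    & NormedModule C V := {
  hform : {dot V for (@Num.conj C)};
  hform_normE : forall x : V, `|x| ^+ 2 = hform x x
}.

#[short(type="preHilbertType")]
HB.structure Definition PreHilbert (C : numClosedFieldType) :=
  {V of NormedModule_isPreHilbert C V & NormedModule C V}.

#[short(type="hilbertType")]
HB.structure Definition Hilbert (C : numClosedFieldType) :=
  {V of PreHilbert C V & CompleteNormedModule C V}.

Definition hdot (C : numClosedFieldType) (V : preHilbertType C) (x y : V) : C :=
  (hform : {dot V for (@Num.conj C)}) x y.

Section dot_norm.
Variables (C : numClosedFieldType) (V : lmodType C).
Variable f : {dot V for (@Num.conj C)}.

Lemma dot_cauchy_schwarz (x y : V) : `|f x y| ^+ 2 <= f x x * f y y.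
Proof.
have [->|y0] := eqVneq y 0.
  by rewrite !linear0r normr0 expr0n mulr0.
have fy : 0 < f y y by rewrite dnorm_gt0.
pose a := f x y / f y y.
have : 0 <= f (x - a *: y) (x - a *: y) by exact: dnorm_ge0.
have fyx : f y x = (f x y)^* by rewrite (hermC f y x) /= expr0 mul1r.
have cfy : (f y y)^* = f y y by apply: geC0_conj; exact: ltW.
have ca : a^* = (f x y)^* / f y y by rewrite /a rmorphM /= fmorphV /= cfy.
have -> : f (x - a *: y) (x - a *: y) = f x x - `|f x y| ^+ 2 / f y y.
  rewrite linearBl !linearBr !linearZl_LR !linearZr_LR /= fyx ca /a normCK.
  by field; rewrite gt_eqF.
by rewrite subr_ge0 ler_pdivrMr.
Qed.

Lemma dot_normD (x y : V) :
  sqrtC (f (x + y) (x + y)) <= sqrtC (f x x) + sqrtC (f y y).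
Proof.
have s0 u : 0 <= sqrtC (f u u) by rewrite sqrtC_ge0 dnorm_ge0.
rewrite -(@ler_pXn2r _ 2) ?nnegrE ?addr_ge0// sqrrD !sqrtCK dnormD.
rewrite [leRHS]addrAC lerD2l -mulr_natr.
have -> : f x y + (f x y)^* = 'Re (f x y) * 2.
  by rewrite ReE divfK// pnatr_eq0.
rewrite ler_wpM2r//; apply: le_trans (leif_Re_Creal _) _.
rewrite -(@ler_pXn2r _ 2) ?nnegrE ?mulr_ge0//.
by rewrite exprMn !sqrtCK dot_cauchy_schwarz.
Qed.

End dot_norm.

HB.factory Record Lmodule_isPreHilbert (C : numClosedFieldType) V
    & GRing.Lmodule C V := {
  dot_form : {dot V for (@Num.conj C)}
}.

HB.builders Context C V & Lmodule_isPreHilbert C V.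

Let dnorm (x : V) : C :=
  sqrtC ((dot_form : {dot V for (@Num.conj C)}) x x).

Let dnormD (x y : V) : dnorm (x + y) <= dnorm x + dnorm y.
Proof. exact: dot_normD. Qed.

Let dnormZ (a : C) (x : V) : dnorm (a *: x) = `|a| * dnorm x.
Proof.
by rewrite /dnorm dnormZ sqrtCM ?nnegrE ?exprn_ge0 ?dnorm_ge0// sqrCK.
Qed.

Let dnorm0_eq0 (x : V) : dnorm x = 0 -> x = 0.
Proof. by move/eqP; rewrite sqrtC_eq0 dnorm_eq0 => /eqP. Qed.

HB.instance Definition _ := Lmodule_isNormed.Build C V dnormD dnormZ dnorm0_eq0.

Let dnormE (x : V) :
  `|x| ^+ 2 = (dot_form : {dot V for (@Num.conj C)}) x x.
Proof. by rewrite /Num.norm/= sqrtCK. Qed.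

HB.instance Definition _ := NormedModule_isPreHilbert.Build C V dnormE.

HB.end.

Definition hilbert_sum (C : numClosedFieldType) (I : finType)
  (H : I -> hilbertType C) : Type := forall i, H i.

Section hilbert_sum.
Variables (C : numClosedFieldType) (I : finType) (H : I -> hilbertType C).
Implicit Types x y z : hilbert_sum H.

HB.instance Definition _ := gen_eqMixin (hilbert_sum H).
HB.instance Definition _ := gen_choiceMixin (hilbert_sum H).

Let hs0 : hilbert_sum H := fun=> 0.
Let hsN x : hilbert_sum H := fun i => - x i.
Let hsD x y : hilbert_sum H := fun i => x i + y i.
Let hsZ (a : C) x : hilbert_sum H := fun i => a *: x i.

Let hsDA : associative hsD.
Proof. by move=> x y z; apply/functional_extensionality_dep => i; exact: addrA. Qed.
Let hsDC : commutative hsD.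
Proof. by move=> x y; apply/functional_extensionality_dep => i; exact: addrC. Qed.
Let hs0D : left_id hs0 hsD.
Proof. by move=> x; apply/functional_extensionality_dep => i; exact: add0r. Qed.
Let hsND : left_inverse hs0 hsN hsD.
Proof. by move=> x; apply/functional_extensionality_dep => i; exact: addNr. Qed.

HB.instance Definition _ :=
  GRing.isZmodule.Build (hilbert_sum H) hsDA hsDC hs0D hsND.

Let hsZA (a b : C) x : hsZ a (hsZ b x) = hsZ (a * b) x.
Proof. by apply/functional_extensionality_dep => i; exact: scalerA. Qed.
Let hs1Z : left_id 1 hsZ.
Proof. by move=> x; apply/functional_extensionality_dep => i; exact: scale1r. Qed.
Let hsZDr : right_distributive hsZ +%R.
Proof.
by move=> a x y; apply/functional_extensionality_dep => i; exact: scalerDr.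
Qed.
Let hsZDl x : {morph hsZ^~ x : a b / a + b}.
Proof.
by move=> a b; apply/functional_extensionality_dep => i; exact: scalerDl.
Qed.

HB.instance Definition _ :=
  GRing.Zmodule_isLmodule.Build C (hilbert_sum H) hsZA hs1Z hsZDr hsZDl.

Lemma hilbert_sumDE x y i : (x + y) i = x i + y i. Proof. by []. Qed.
Lemma hilbert_sumNE x i : (- x) i = - x i. Proof. by []. Qed.
Lemma hilbert_sumZE (a : C) x i : (a *: x) i = a *: x i. Proof. by []. Qed.

Definition hilbert_sum_dot x y : C := \sum_i hdot (x i) (y i).

Let hs_dot_bilinear :
  bilinear_for *%R (@Num.conj C \; *%R) hilbert_sum_dot.
Proof.
split=> [y|x] a u v; rewrite /hilbert_sum_dot /=.
  rewrite mulr_sumr -big_split/=; apply: eq_bigr => i _.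
  by rewrite hilbert_sumDE hilbert_sumZE /hdot linearPl.
rewrite mulr_sumr -big_split/=; apply: eq_bigr => i _.
by rewrite hilbert_sumDE hilbert_sumZE /hdot linearPr.
Qed.

HB.instance Definition _ := bilinear_isBilinear.Build C
  (hilbert_sum H) (hilbert_sum H) C *%R (@Num.conj C \; *%R)
  hilbert_sum_dot hs_dot_bilinear.

Let hs_dot_herm x y :
  hilbert_sum_dot x y = (-1) ^+ false * (hilbert_sum_dot y x)^*.
Proof.
rewrite expr0 mul1r rmorph_sum; apply: eq_bigr => i _.
by rewrite /hdot hermC /= expr0 mul1r.
Qed.

HB.instance Definition _ := isHermitianSesquilinear.Build C (hilbert_sum H)
  false (@Num.conj C) hilbert_sum_dot hs_dot_herm.

Let hs_dot_gt0 x : x != 0 -> 0 < hilbert_sum_dot x x.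
Proof.
move=> x0; rewrite lt_def sumr_ge0 ?andbT; last by move=> i _; exact: dnorm_ge0.
apply: contra x0; rewrite psumr_eq0; last by move=> i _; exact: dnorm_ge0.
move=> /allP x0; apply/eqP/functional_extensionality_dep => i; apply/eqP.
by have := x0 i (mem_index_enum _); rewrite /= /hdot dnorm_eq0.
Qed.

HB.instance Definition _ := isDotProduct.Build C (hilbert_sum H)
  hilbert_sum_dot hs_dot_gt0.

HB.instance Definition _ := Lmodule_isPreHilbert.Build C (hilbert_sum H)
  (hilbert_sum_dot : {dot (hilbert_sum H) for (@Num.conj C)}).

Lemma hilbert_sum_normE x : `|x| ^+ 2 = \sum_i `|x i| ^+ 2.
Proof. by rewrite hform_normE /=; apply: eq_bigr => i _; rewrite hform_normE. Qed.

Lemma ler_hilbert_sum_norm x i : `|x i| <= `|x|.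
Proof.
rewrite -(@ler_pXn2r _ 2) ?nnegrE//; rewrite hilbert_sum_normE (bigD1 i)//=.
by rewrite lerDl sumr_ge0// => j _; rewrite exprn_ge0.
Qed.

Lemma hilbert_sum_norm_le x (e : C) : 0 <= e ->
  (forall i, `|x i| <= e) -> `|x| <= e * #|I|%:R.
Proof.
move=> e0 xe; rewrite -(@ler_pXn2r _ 2) ?nnegrE ?mulr_ge0//.
rewrite hilbert_sum_normE exprMn.
apply: (@le_trans _ _ (\sum_(i : I) e ^+ 2)).
  by apply: ler_sum => i _; rewrite ler_pXn2r ?nnegrE.
rewrite sumr_const -[leLHS]mulr_natr ler_wpM2l ?exprn_ge0// -natrX ler_nat.
by case: #|I| => // n; rewrite leq_pmulr.
Qed.

Lemma hilbert_sum_proj_continuous i : continuous (fun x => x i).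
Proof.
move=> x; apply/(@cvgrPdist_le _ _ _ (nbhs x)) => e e0.
have xe : nbhs x (ball x e) by exact: nbhsx_ballx.
move: xe; apply: (@filterS _ _ (nbhs_filter x)) => y.
rewrite -ball_normE /= => /ltW; apply: le_trans.
exact: (ler_hilbert_sum_norm (x - y) i).
Qed.

Lemma hilbert_sum_cvg (T : Type) (F : set_system T) (f : T -> hilbert_sum H)
    (l : hilbert_sum H) :
  Filter F -> (forall i, (fun t => f t i) @ F --> l i) -> f @ F --> l.
Proof.
move=> FF fl; apply/cvgrPdist_le => /= e e0.
have d0 : 0 < e / (#|I|.+1)%:R by rewrite divr_gt0.
have : \forall t \near F, forall i, `|l i - f t i| <= e / (#|I|.+1)%:R.
  by apply: filter_forall => i; have /cvgrPdist_le/(_ _ d0) := fl i.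
apply: filterS => t lt.
apply: le_trans (hilbert_sum_norm_le (ltW d0) lt) _.
by rewrite mulrAC ler_pdivrMr// ler_wpM2l ?ltW// ltr_nat.
Qed.

Let hs_complete (F : set_system (hilbert_sum H)) :
  ProperFilter F -> cauchy F -> cvg F.
Proof.
move=> FF /cauchy_ballP Fc.
have cvgi i : cvg ((fun x : hilbert_sum H => x i) @ F).
  apply: cauchy_cvg; apply/cauchy_ballP => e e0.
  have := Fc e e0; rewrite !near_simpl => -[[P Q] /= [FP FQ] PQ].
  exists ([set u | exists2 x, P x & x i = u], [set u | exists2 x, Q x & x i = u]).
    split; rewrite /nbhs/=.
      by apply: filterS FP => x Px /=; exists x.
    by apply: filterS FQ => x Px /=; exists x.
  move=> [_ _] [/= [x Px <-] [y Qy <-]].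
  have /= := PQ (x, y) (conj Px Qy).
  rewrite -!ball_normE/=; apply: le_lt_trans.
  exact: (ler_hilbert_sum_norm (x - y) i).
pose l : hilbert_sum H := fun i => lim ((fun x : hilbert_sum H => x i) @ F).
by apply/cvg_ex; exists l; apply: (hilbert_sum_cvg (f := id)) => i; exact: cvgi.
Qed.

HB.instance Definition _ := Uniform_isComplete.Build (hilbert_sum H) hs_complete.

End hilbert_sum.

(* Unital complex C*-algebras, with 1 != 0. Rings and normed modules have no
   common extension in the library, so the multiplication is introduced here
   on top of the Banach space structure; the instances that follow equip a
   C*-algebra with the usual ring and algebra notations. *)
HB.mixin Record isCStarAlgebra (C : numClosedFieldType) A
    & CompleteNormedModule C A := {
  cstar_mul : A -> A -> A;
  cstar_one : A;
  star : A -> A;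
  cstar_mulA : associative cstar_mul;
  cstar_mul1 : left_id cstar_one cstar_mul;
  cstar_mulr1 : right_id cstar_one cstar_mul;
  cstar_mulDl : left_distributive cstar_mul +%R;
  cstar_mulDr : right_distributive cstar_mul +%R;
  cstar_mulZl : forall (a : C) (x y : A),
    a *: cstar_mul x y = cstar_mul (a *: x) y;
  cstar_mulZr : forall (a : C) (x y : A),
    a *: cstar_mul x y = cstar_mul x (a *: y);
  cstar_oner_neq0 : cstar_one != 0;
  starK : involutive star;
  starD : {morph star : x y / x + y};
  starZ : forall (a : C) (x : A), star (a *: x) = a^* *: star x;
  starM : forall x y : A, star (cstar_mul x y) = cstar_mul (star y) (star x);
  cstar_normM : forall x y : A, `|cstar_mul x y| <= `|x| * `|y|;
  cstar_normE : forall x : A, `|cstar_mul (star x) x| = `|x| ^+ 2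
}.

#[short(type="cstarAlgType")]
HB.structure Definition CStarAlgebra (C : numClosedFieldType) :=
  {A of isCStarAlgebra C A & CompleteNormedModule C A}.

#[non_forgetful_inheritance]
HB.instance Definition _ (C : numClosedFieldType) (A : cstarAlgType C) :=
  GRing.Zmodule_isNzRing.Build (CStarAlgebra.sort A) (@cstar_mulA C A)
    (@cstar_mul1 C A) (@cstar_mulr1 C A) (@cstar_mulDl C A) (@cstar_mulDr C A)
    (@cstar_oner_neq0 C A).

#[non_forgetful_inheritance]
HB.instance Definition _ (C : numClosedFieldType) (A : cstarAlgType C) :=
  GRing.Lmodule_isLalgebra.Build C (CStarAlgebra.sort A) (@cstar_mulZl C A).

#[non_forgetful_inheritance]
HB.instance Definition _ (C : numClosedFieldType) (A : cstarAlgType C) :=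
  GRing.Lalgebra_isAlgebra.Build C (CStarAlgebra.sort A) (@cstar_mulZr C A).

Section cuntz_krieger.
Variables (C : numClosedFieldType) (N : nat).
Implicit Types (M : 'M[bool]_N) (B O : cstarAlgType C).

(* A 0/1 matrix is a boolean matrix, read through the coercion to nat. *)
Definition nondegenerate_mx M : Prop :=
  (forall i, exists j, M i j) /\ (forall j, exists i, M i j).

Definition partial_isometry B (x : B) : Prop := x * star x * x = x.

Definition cuntz_krieger_family M B (t : 'I_N -> B) : Prop :=
  [/\ forall i, partial_isometry (t i),
      forall i, star (t i) * t i = \sum_j (M i j)%:R *: (t j * star (t j)) &
      \sum_i t i * star (t i) = 1].

Definition cstar_generated B (t : 'I_N -> B) : Prop :=
  forall D : set B, closed D -> (forall i, D (t i)) ->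
    (forall x y, D x -> D y -> D (x + y)) ->
    (forall (a : C) x, D x -> D (a *: x)) ->
    (forall x y, D x -> D y -> D (x * y)) ->
    (forall x, D x -> D (star x)) ->
  D = setT.

(* (O, s) is the Cuntz-Krieger algebra of M with its canonical generators:
   these determine it up to a unique *-isomorphism. *)
Definition is_cuntz_krieger_algebra M O (s : 'I_N -> O) : Prop :=
  [/\ cuntz_krieger_family M s, cstar_generated s &
      forall B (t : 'I_N -> B), cuntz_krieger_family M t ->
      exists phi : {lrmorphism O -> B},
        (forall x, phi (star x) = star (phi x)) /\ (forall i, phi (s i) = t i)].

End cuntz_krieger.

Record representation (C : numClosedFieldType) (O : cstarAlgType C) :=
  Representation {
  rep_space :> hilbertType C;
  rep_op : O -> {linear rep_space -> rep_space};
  rep_op_continuous : forall x, continuous (rep_op x);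
  rep_opD : forall x y u, rep_op (x + y) u = rep_op x u + rep_op y u;
  rep_opZ : forall (a : C) x u, rep_op (a *: x) u = a *: rep_op x u;
  rep_opM : forall x y u, rep_op (x * y) u = rep_op x (rep_op y u);
  rep_op1 : forall u, rep_op 1 u = u;
  rep_op_star : forall x u v,
    hdot (rep_op (star x) u) v = hdot u (rep_op x v)
}.

Definition unitarily_equivalent (C : numClosedFieldType) (O : cstarAlgType C)
    (pi1 pi2 : representation O) : Prop :=
  exists U : {linear pi1 -> pi2},
    [/\ forall u v, hdot (U u) (U v) = hdot u v,
        forall w, exists u, U u = w &
        forall x u, U (rep_op pi1 x u) = rep_op pi2 x (U u)].

Section representation_sum.
Variables (C : numClosedFieldType) (O : cstarAlgType C) (I : finType).
Variable sigma : I -> representation O.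

Definition rep_sum_op (x : O) (u : hilbert_sum sigma) : hilbert_sum sigma :=
  fun i => rep_op (sigma i) x (u i).

Let rep_sum_op_linear x : linear (rep_sum_op x).
Proof.
by move=> a u v; apply/functional_extensionality_dep => i; exact: linearP.
Qed.

HB.instance Definition _ x := GRing.isLinear.Build C (hilbert_sum sigma)
  (hilbert_sum sigma) *:%R (rep_sum_op x) (rep_sum_op_linear x).

Let rep_sum_op_continuous x : continuous (rep_sum_op x).
Proof.
move=> u; apply: (@hilbert_sum_cvg _ _ _ _ (nbhs u)) => i.
apply: (cvg_comp (fun v : hilbert_sum sigma => v i) (rep_op (sigma i) x)).
  exact: hilbert_sum_proj_continuous.
exact: rep_op_continuous.
Qed.

Let rep_sum_opD x y u : rep_sum_op (x + y) u = rep_sum_op x u + rep_sum_op y u.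
Proof. by apply/functional_extensionality_dep => i; exact: rep_opD. Qed.

Let rep_sum_opZ (a : C) x u : rep_sum_op (a *: x) u = a *: rep_sum_op x u.
Proof. by apply/functional_extensionality_dep => i; exact: rep_opZ. Qed.

Let rep_sum_opM x y u : rep_sum_op (x * y) u = rep_sum_op x (rep_sum_op y u).
Proof. by apply/functional_extensionality_dep => i; exact: rep_opM. Qed.

Let rep_sum_op1 u : rep_sum_op 1 u = u.
Proof. by apply/functional_extensionality_dep => i; exact: rep_op1. Qed.

Let rep_sum_op_star x (u v : hilbert_sum sigma) :
  hdot (rep_sum_op (star x) u) v = hdot u (rep_sum_op x v).
Proof. by apply: eq_bigr => i _; exact: rep_op_star. Qed.

Definition representation_sum : representation O :=
  @Representation C O (hilbert_sum sigma) (fun x => rep_sum_op x)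
    rep_sum_op_continuous rep_sum_opD rep_sum_opZ rep_sum_opM rep_sum_op1
    rep_sum_op_star.

End representation_sum.

Section cycle_representations.
Variables (C : numClosedFieldType) (N : nat).

Definition cyclic_word (M : 'M[bool]_N) (J : seq 'I_N) : Prop :=
  J != [::] /\ cycle (fun i j => M i j) J.

Definition word_power (J : seq 'I_N) (p : nat) : seq 'I_N :=
  flatten (nseq p J).

Variables (O : cstarAlgType C) (s : 'I_N -> O).

Definition cyclic_vector (pi : representation O) (Omega : pi) : Prop :=
  closure (range (fun x => rep_op pi x Omega)) = setT.

Definition word_op (pi : representation O) (J : seq 'I_N) : pi -> pi :=
  rep_op pi (\prod_(i <- J) s i).

(* The vectors pi(s_(j_l) ... s_(j_k)) Omega, 1 <= l <= k, are indexed here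
   by the number l - 1 of letters dropped from J. *)
Definition is_P (J : seq 'I_N) (z : C) (pi : representation O) : Prop :=
  exists Omega : pi,
    [/\ `|Omega| = 1, cyclic_vector Omega,
        word_op J Omega = z *: Omega &
        forall l m, (l < size J)%N -> (m < size J)%N ->
          hdot (word_op (drop l J) Omega) (word_op (drop m J) Omega) =
          (l == m)%:R].

End cycle_representations.

(* e ^ (2 pi i / p) *)
Definition unity_root (R : realType) (p : nat) : R[i] :=
  (cos (2 * pi / p%:R) +i* sin (2 * pi / p%:R))%C.

(* Main.v *)
From HB Require Import structures.
Require Import Defs.
From mathcomp Require Import all_boot all_order all_algebra.
From mathcomp Require Import sesquilinear complex ring lra.
From mathcomp Require Import mathcomp_extra boolp classical_sets functions.
From mathcomp Require Import reals topology normedtype trigo.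

(** Why the theorem holds.  Write k for the length of J, w for the primitive
    p-th root of unity e^(2 pi i / p) and z_j = r w^j, so that the z_j are the
    p distinct p-th roots of c = r^p.

    The sum of the P(J; z_j) is P(J^p; c) ([is_P_sum]).  Let Omega_j be the
    cyclic vector of the j-th summand and let Omega be p^(-1/2) times the sum
    of the Omega_j.  The word J multiplies Omega_j by z_j, hence J^p multiplies
    Omega by c.  Deleting l = a k + b letters from J^p leaves the word J with b
    letters deleted followed by p - 1 - a copies of J; so, when two such
    vectors are paired, the orthonormality in the summands settles the
    remainders b, and a sum over the roots z_j settles the quotients a.
    Conversely a discrete Fourier transform over the powers of J gives elements
    of the algebra that carry Omega to each Omega_j
    ([average_vector_component]); so Omega is cyclic because the Omega_j are.

    Any two representations that are P(K; z) for the same K and z are unitarily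
    equivalent ([cycle_vector_unique]).  In a Cuntz-Krieger algebra the adjoint
    of a generator s_i sends the l-th vector of the cycle to the next one, or to
    0 if i is not the l-th letter.  The lines spanned by the cycle are therefore
    permuted or killed by the adjoints of the generators, by the same rule in
    both representations.  This is all that is needed: consider a set V of pairs
    (u, u') of vectors that is stable under the adjoints of the generators and
    on which both inner products agree.  The closed span W of the words in the
    generators applied to V is then stable under the whole algebra, and both
    inner products agree on it, because every word can be moved across the
    inner product and absorbed ([coinvariant_hull_same_dot]).  So W is the graph
    of a unitary intertwiner as soon as V contains a pair of cyclic vectors.

    Passing from the generators to the whole algebra requires the orbit maps
    x |-> pi(x) u to be norm continuous, whereas a representation is only
    assumed to consist of continuous operators.  This is the automatic
    continuity of *-representations ([rep_op_continuous_l]): for small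
    self-adjoint a, the element 1 - a is the square of a self-adjoint element
    ([sqrt_one_sub]), which bounds <pi(a) u, u> by <u, u>. *)

Set Implicit Arguments.
Unset Strict Implicit.
Unset Printing Implicit Defensive.

Import Order.TTheory GRing.Theory Num.Theory.
Import numFieldNormedType.Exports.

Local Open Scope classical_set_scope.
Local Open Scope ring_scope.

(** * Inner products *)

Section inner_product.
Variables (C : numClosedFieldType) (V : preHilbertType C).
Implicit Types (u v w : V) (a : C).

Lemma hdotDl u v w : hdot (u + v) w = hdot u w + hdot v w.
Proof. by rewrite /hdot linearDl. Qed.

Lemma hdotBl u v w : hdot (u - v) w = hdot u w - hdot v w.
Proof. by rewrite /hdot linearBl. Qed.

Lemma hdotZl a u w : hdot (a *: u) w = a * hdot u w.
Proof. by rewrite /hdot linearZl_LR. Qed.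

Lemma hdot0l w : hdot 0 w = 0.
Proof. by rewrite /hdot linear0l. Qed.

Lemma hdotC u v : hdot u v = (hdot v u)^*.
Proof. by rewrite /hdot hermC /= expr0 mul1r. Qed.

Lemma hdotBr u v w : hdot w (u - v) = hdot w u - hdot w v.
Proof. by rewrite hdotC hdotBl rmorphB /= -!hdotC. Qed.

Lemma hdotZr a u w : hdot w (a *: u) = a^* * hdot w u.
Proof. by rewrite hdotC hdotZl rmorphM /= -hdotC. Qed.

Lemma hdot_suml (I : finType) (F : I -> V) w :
  hdot (\sum_i F i) w = \sum_i hdot (F i) w.
Proof.
by apply: (big_morph (fun u => hdot u w)) => [u v|]; rewrite ?hdotDl ?hdot0l.
Qed.

Lemma hdot_norm u : hdot u u = `|u| ^+ 2.
Proof. by rewrite hform_normE. Qed.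

Lemma hdot_eq0 u : (hdot u u == 0) = (u == 0).
Proof. by rewrite hdot_norm sqrf_eq0 normr_eq0. Qed.

Lemma hdot_ge0 u : 0 <= hdot u u.
Proof. by rewrite hdot_norm exprn_ge0. Qed.

Lemma norm_hdot_le u v : `|hdot u v| <= `|u| * `|v|.
Proof.
rewrite -(@ler_pXn2r _ 2) ?nnegrE ?mulr_ge0// exprMn -!hdot_norm.
exact: dot_cauchy_schwarz.
Qed.

End inner_product.

Lemma lipschitz_continuous (C : numFieldType) (V W : normedModType C)
    (f : V -> W) (k : C) :
  0 <= k -> (forall x y, `|f x - f y| <= k * `|x - y|) -> continuous f.
Proof.
move=> k0 fk x; apply/(@cvgrPdist_lt _ _ _ (nbhs x)) => e e0.
have d0 : 0 < e / (k + 1) by rewrite divr_gt0// ltr_wpDl.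
have : nbhs x (ball x (e / (k + 1))) by exact: nbhsx_ballx.
apply: (@filterS _ _ (nbhs_filter x)) => y; rewrite -ball_normE /= => xy.
apply: (le_lt_trans (fk x y)).
apply: (@le_lt_trans _ _ ((k + 1) * `|x - y|)).
  by rewrite ler_wpM2r// lerDl.
by rewrite mulrC -ltr_pdivlMr// ltr_wpDl.
Qed.

Lemma hdot_continuous_l (C : numClosedFieldType) (V : preHilbertType C)
  (w : V) : continuous (fun u => hdot u w).
Proof.
apply: (@lipschitz_continuous _ _ _ _ `|w|) => // u v.
by rewrite -hdotBl mulrC norm_hdot_le.
Qed.

(** * Square roots in C-star algebras *)

Section cstar.
Variables (C : numClosedFieldType) (O : cstarAlgType C).
Implicit Types (x y : O).

Lemma cstar_norm_mul_le x y : `|x * y| <= `|x| * `|y|.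
Proof. exact: cstar_normM. Qed.

Lemma cstar_starM x y : star (x * y) = star y * star x.
Proof. exact: starM. Qed.

Lemma star1 : star 1 = 1 :> O.
Proof.
by rewrite -[LHS]mulr1 -{2}(starK 1) -cstar_starM mulr1 starK.
Qed.

Lemma starB x y : star (x - y) = star x - star y.
Proof. by rewrite starD -scaleN1r starZ rmorphN rmorph1 scaleN1r. Qed.

Lemma norm_star x : `|star x| = `|x|.
Proof.
suff le y : `|y| <= `|star y|.
  by apply/eqP; rewrite eq_le le -{2}(starK x) le.
have [->|y0] := eqVneq y 0; first by rewrite normr0.
rewrite -(ler_pM2r (x := `|y|)) ?normr_gt0// -expr2 -cstar_normE.
exact: cstar_normM.
Qed.

Lemma star_continuous : continuous (star : O -> O).
Proof.
apply: (@lipschitz_continuous _ _ _ _ 1) => // x y.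
by rewrite -starB norm_star mul1r.
Qed.

End cstar.

Lemma half_expr_lt (R : realType) (e : R[i]) :
  0 < e -> exists n, 2^-1 ^+ n < e.
Proof.
move=> e0; have t0 : 0 < e^-1 by rewrite invr_gt0.
have et : (complex.Re e^-1)%:C%C = e^-1 by apply: RRe_real; exact: gtr0_real.
exists (Num.bound (complex.Re e^-1)).
rewrite -[ltRHS]invrK exprVn ltf_pV2 ?posrE ?exprn_gt0// -et.
apply: (@lt_le_trans _ _ (Num.bound (complex.Re e^-1))%:R).
  rewrite -(rmorph_nat (real_complex R)) ltcR; apply: archi_boundP.
  by rewrite -lecR et ltW.
by rewrite -natrX ler_nat ltnW// ltn_expl.
Qed.

Section sqrt.
Variables (R : realType) (O : cstarAlgType R[i]).
Variable (a : O).
Hypothesis star_a : star a = a.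
Hypothesis norm_a : `|a| <= 4^-1.

(* The square root is 1 - y, where y solves y = (a + y ^ 2) / 2. *)
Let F (y : O) : O := 2^-1 *: (a + y * y).
Let y_ n := iter n F 0.

(* The ball of radius 1/2 is stable, and [F] halves distances there. *)
Let norm_y n : `|y_ n| <= 2^-1.
Proof.
elim: n => [|n IH]; first by rewrite /y_/= normr0 invr_ge0.
rewrite /y_/= -/(y_ n) /F normrZ normfV normr_nat.
rewrite -[leRHS]mulr1 ler_wpM2l ?invr_ge0//.
apply: (le_trans (ler_normD _ _)).
apply: (@le_trans _ _ (4^-1 + 2^-1 * 2^-1)).
  apply: lerD => //; apply: (le_trans (cstar_norm_mul_le _ _)).
  by apply: ler_pM.
have -> : 4^-1 + 2^-1 * 2^-1 = 2^-1 :> R[i] by field.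
by rewrite invf_le1 ?ler1n.
Qed.

Let F_contract x y : `|x| <= 2^-1 -> `|y| <= 2^-1 ->
  `|F x - F y| <= 2^-1 * `|x - y|.
Proof.
move=> hx hy; rewrite /F -scalerBr normrZ normfV normr_nat.
rewrite ler_wpM2l ?invr_ge0//.
have -> : a + x * x - (a + y * y) = x * (x - y) + (x - y) * y.
  by rewrite mulrBr mulrBl opprD addrACA subrr add0r addrA subrK.
apply: (le_trans (ler_normD _ _)).
apply: (@le_trans _ _ (2^-1 * `|x - y| + `|x - y| * 2^-1)).
  by apply: lerD; apply: (le_trans (cstar_norm_mul_le _ _));
    [apply: ler_wpM2r | apply: ler_wpM2l].
rewrite [X in _ + X]mulrC -mulrDl.
have -> : 2^-1 + 2^-1 = 1 :> R[i] by field.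
by rewrite mul1r.
Qed.

Let y_dist n m : `|y_ (n + m) - y_ n| <= 2^-1 ^+ n.
Proof.
elim: n => [|n IH].
  rewrite /y_ /= subr0 expr0; apply: (le_trans (norm_y m)).
  by rewrite invf_le1 ?ler1n.
rewrite addSn exprS; apply: (le_trans (F_contract (norm_y _) (norm_y _))).
by rewrite ler_wpM2l ?invr_ge0.
Qed.

(** The root is the limit of the iterates of [F]; it is self-adjoint because the
    iterates are and the involution is continuous. *)
Lemma sqrt_one_sub : exists2 b : O, star b = b & b * b = 1 - a.
Proof.
have star_y n : star (y_ n) = y_ n.
  elim: n => [|n IH].
    by rewrite /y_/= -(scale0r 0) starZ rmorph0 !scale0r.
  rewrite /y_/= -/(y_ n) /F starZ fmorphV rmorph_nat starD cstar_starM.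
  by rewrite IH star_a.
have /cauchy_cvg/cvg_ex[y yl] : cauchy (y_ @ \oo).
  apply: cauchy_exP => e e0; have [n ne] := half_expr_lt e0.
  exists (y_ n); exists n => // m /= nm.
  rewrite -ball_normE /= distrC -(subnKC nm).
  exact: le_lt_trans ne.
have star_yl : star y = y.
  apply: (@cvg_unique _ _ (y_ @ \oo)) => //=.
  rewrite -(_ : star \o y_ = y_); last by apply/funext => n /=; rewrite star_y.
  by apply: cvg_comp yl _; exact: star_continuous.
have ny : `|y| <= 2^-1.
  apply/ler_addgt0Pr => e e0.
  have /cvgrPdist_le/(_ e e0) := yl; move=> [n _ /(_ n (leqnn n))] /= yn.
  rewrite -(subrK (y_ n) y) addrC.
  by apply: (le_trans (ler_normD _ _)); exact: lerD.
have Fy : F y = y.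
  apply: (@cvg_unique _ _ (y_ @ \oo)) => //=.
  apply/cvgrPdist_le => e e0; apply/near_inftyS.
  move/cvgrPdist_le : yl => /(_ e e0); apply: filterS => n hn.
  apply: (le_trans (F_contract ny (norm_y n))).
  apply: le_trans hn; rewrite ler_piMl// invf_le1 ?ler1n//.
exists (1 - y); first by rewrite starB star1 star_yl.
have yy : y + y = a + y * y.
  rewrite -[in LHS]Fy /F -scalerDl; have -> : 2^-1 + 2^-1 = 1 :> R[i] by field.
  by rewrite scale1r.
rewrite mulrBl !mulrBr !mul1r mulr1 opprB -addrA; congr (_ + _).
by rewrite addrCA -opprD yy opprD addrCA subrr addr0.
Qed.

End sqrt.

(** * Continuity of representations *)

Section rep_continuity.
Variables (R : realType) (O : cstarAlgType R[i]) (pi : representation O).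
Implicit Types (x : O) (u : pi).

Lemma rep_op_starr x u v :
  hdot (rep_op pi x u) v = hdot u (rep_op pi (star x) v).
Proof. by rewrite -rep_op_star starK. Qed.

Lemma rep_opB x y u : rep_op pi (x - y) u = rep_op pi x u - rep_op pi y u.
Proof. by rewrite -scaleN1r rep_opD rep_opZ scaleN1r. Qed.

Lemma rep_op0 u : rep_op pi 0 u = 0.
Proof. by rewrite -(scale0r (0 : O)) rep_opZ scale0r. Qed.

Lemma rep_op_sum (I : finType) (F : I -> O) u :
  rep_op pi (\sum_i F i) u = \sum_i rep_op pi (F i) u.
Proof.
by apply: (big_morph (fun x => rep_op pi x u)) => [x y|];
  rewrite ?rep_opD ?rep_op0.
Qed.

(** For x* x = a, the self-adjoint root b of 1 - a gives
    0 <= |pi(b) u|^2 = |u|^2 - |pi(x) u|^2. *)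
Lemma rep_op_contract x u : `|x| <= 2^-1 -> `|rep_op pi x u| <= `|u|.
Proof.
move=> x1; rewrite -(@ler_pXn2r _ 2) ?nnegrE// -!hdot_norm.
rewrite rep_op_starr -rep_opM.
have [||b sb bb] := @sqrt_one_sub _ _ (star x * x).
- by rewrite cstar_starM starK.
- rewrite (cstar_normE x) (_ : 4^-1 = 2^-1 ^+ 2); last by field.
  by rewrite ler_pXn2r ?nnegrE ?invr_ge0.
have := hdot_ge0 (rep_op pi b u).
by rewrite rep_op_starr sb -rep_opM bb rep_opB rep_op1 hdotBr subr_ge0.
Qed.

Lemma rep_op_bounded x u : `|rep_op pi x u| <= 2 * `|u| * `|x|.
Proof.
have [->|x0] := eqVneq x 0; first by rewrite rep_op0 !normr0 mulr0.
have nx : 0 < `|x| by rewrite normr_gt0.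
have := @rep_op_contract ((2 * `|x|)^-1 *: x) u.
rewrite rep_opZ !normrZ !normfV !normrM !normr_nat normr_id.
have -> : (2 * `|x|)^-1 * `|x| = 2^-1 by field; rewrite gt_eqF.
move=> /(_ (lexx _)); rewrite mulrC ler_pdivrMr ?mulr_gt0//.
by rewrite mulrA (mulrC `|u|).
Qed.

Lemma rep_op_continuous_l u : continuous (fun x => rep_op pi x u).
Proof.
apply: (@lipschitz_continuous _ _ _ _ (2 * `|u|)) => [|x y].
  by rewrite mulr_ge0.
by rewrite -rep_opB rep_op_bounded.
Qed.

End rep_continuity.

(** * Closed subspaces *)

Section closed_subspaces.
Variable C : numFieldType.

Definition closed_subspace (V : normedModType C) (E : set V) : Prop :=
  [/\ closed E, E 0, forall u v, E u -> E v -> E (u + v) &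
      forall (a : C) u, E u -> E (a *: u)].

(** The closure of the linear span, as an intersection: a property of its
    vectors is then proved by exhibiting a closed subspace. *)
Definition closed_span (V : normedModType C) (S : set V) : set V :=
  fun u => forall E, closed_subspace E -> S `<=` E -> E u.

Lemma closed_span_sub (V : normedModType C) (S : set V) :
  S `<=` closed_span S.
Proof. by move=> u Su E _; apply. Qed.

Lemma closed_span_closed_subspace (V : normedModType C) (S : set V) :
  closed_subspace (closed_span S).
Proof.
split.
- move=> u clu E sE SE; have [cE _ _ _] := sE.
  by apply: cE; apply: closure_subset clu => v; apply.
- by move=> E [].
- move=> u v hu hv E sE SE; have [_ _ EA _] := sE.
  by apply: EA; [exact: hu|exact: hv].
- by move=> a u hu E sE SE; have [_ _ _ EZ] := sE; apply: EZ; exact: hu.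
Qed.

Lemma closed_subspace_preimage (V W : normedModType C) (f : {linear V -> W})
    (E : set W) :
  continuous f -> closed_subspace E -> closed_subspace (f @^-1` E).
Proof.
move=> cf [cE E0 EA EZ]; split.
- by apply: preimage_closed cE => x _; exact: cf.
- by rewrite /= linear0.
- by move=> u v /= Eu Ev; rewrite linearD; exact: EA.
- by move=> a u /= Eu; rewrite linearZ; exact: EZ.
Qed.

Lemma closed_subspace_sum (V : normedModType C) (E : set V) (I : finType)
    (F : I -> V) :
  closed_subspace E -> (forall i, E (F i)) -> E (\sum_i F i).
Proof. by move=> [_ E0 EA _] EF; elim/big_ind: _. Qed.

Lemma closed_subspaceB (V : normedModType C) (E : set V) u v :
  closed_subspace E -> E u -> E v -> E (u - v).
Proof.
by move=> [_ _ EA EZ] Eu Ev; apply: EA => //; rewrite -scaleN1r; exact: EZ.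
Qed.

End closed_subspaces.

(** * Closed graphs of partial isometries *)

(** A closed subspace of a product on which both coordinates have the same norm
    is the graph of a linear isometry between closed subspaces. *)
Section isometric_graph.
Variables (C : numFieldType) (V1 V2 : completeNormedModType C).
Variable W : set (V1 * V2).
Hypothesis W_subspace : closed_subspace W.
Hypothesis W_isometric : forall w, W w -> `|w.1| = `|w.2|.

Lemma isometric_graph_functional u v1 v2 : W (u, v1) -> W (u, v2) -> v1 = v2.
Proof.
move=> h1 h2; have := W_isometric (closed_subspaceB W_subspace h1 h2).
by rewrite /= subrr normr0 => /esym/eqP; rewrite normr_eq0 subr_eq0 => /eqP.
Qed.

(** Since W is isometric, a Cauchy filter of first coordinates yields a Cauchy
    filter of second coordinates; so W projects onto everything once its first
    projection is dense. *)
Lemma isometric_graph_total (X : Type) (f : X -> V1) (g : X -> V2) :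
  (forall x, W (f x, g x)) -> closure (range f) = setT ->
  forall u, exists v, W (u, v).
Proof.
move=> Wfg fdense u.
pose B e := [set x : X | `|u - f x| < e].
pose F := filter_from [set e : C | 0 < e] B.
have FF : ProperFilter F.
  apply: filter_from_proper; last first.
    move=> e /= e0; have : closure (range f) u by rewrite fdense.
    move=> /(_ (ball u e) (nbhsx_ballx _ _ e0)) [_ [[x _ <-]]].
    by rewrite -ball_normE /= => xe; exists x.
  apply: filter_from_filter; first by exists 1 => /=.
  move=> d e /= d0 e0.
  have [de|/ltW ed] := real_leP (gtr0_real d0) (gtr0_real e0).
    by exists d => // x /= xd; split => //; exact: lt_le_trans de.
  by exists e => // x /= xe; split => //; exact: lt_le_trans ed.
have fF : f @ F --> u.
  by apply/cvgrPdist_lt => e e0; exists e.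
have : cauchy (g @ F).
  apply: cauchy_exP => e e0.
  have e20 : 0 < e / 2 by rewrite divr_gt0.
  have [x xe] : exists x, B (e / 2) x.
    by apply: (@filter_ex _ F); exists (e / 2).
  exists (g x); exists (e / 2) => // y ye; rewrite -ball_normE /=.
  have := W_isometric (closed_subspaceB W_subspace (Wfg x) (Wfg y)).
  rewrite /= => <-.
  rewrite -(subrKA u) (splitr e); apply: le_lt_trans (ler_normD _ _) _.
  by apply: ltrD => //; rewrite distrC.
move=> /cauchy_cvg/cvg_ex[v gv]; exists v.
have [Wc _ _ _] := W_subspace.
apply: (@closed_cvg _ _ F _ (fun x => (f x, g x)) _ Wc); first exact: nearW.
exact: (cvg_pair fF gv).
Qed.

End isometric_graph.

(** * Pairs of representations *)

Section pair_action.
Variables (R : realType) (O : cstarAlgType R[i]).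
Variables (pi1 pi2 : representation O).

Definition pair_op (x : O) (w : pi1 * pi2) : pi1 * pi2 :=
  (rep_op pi1 x w.1, rep_op pi2 x w.2).

Let pair_op_linear x : linear (pair_op x).
Proof. by move=> a u v; rewrite /pair_op /= !linearP. Qed.

HB.instance Definition _ x := GRing.isLinear.Build _ (pi1 * pi2)%type
  (pi1 * pi2)%type _ (pair_op x) (pair_op_linear x).

Lemma pair_op_continuous x : continuous (pair_op x).
Proof.
move=> w; apply: cvg_pair.
  apply: (cvg_comp fst (rep_op pi1 x)); first exact: cvg_fst.
  exact: rep_op_continuous.
apply: (cvg_comp snd (rep_op pi2 x)); first exact: cvg_snd.
exact: rep_op_continuous.
Qed.

Lemma pair_op_continuous_l w : continuous (fun x => pair_op x w).
Proof. by move=> x; apply: cvg_pair; exact: rep_op_continuous_l. Qed.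

Lemma pair_opM x y w : pair_op (x * y) w = pair_op x (pair_op y w).
Proof. by rewrite /pair_op !rep_opM. Qed.

Lemma pair_op1 w : pair_op 1 w = w.
Proof. by rewrite /pair_op !rep_op1; case: w. Qed.

Lemma pair_opD x y w : pair_op (x + y) w = pair_op x w + pair_op y w.
Proof. by rewrite /pair_op !rep_opD. Qed.

Lemma pair_opZ (a : R[i]) x w : pair_op (a *: x) w = a *: pair_op x w.
Proof. by rewrite /pair_op !rep_opZ. Qed.

Lemma pair_op_sum (I : finType) (F : I -> O) w :
  pair_op (\sum_i F i) w = \sum_i pair_op (F i) w.
Proof.
apply: (big_morph (fun x => pair_op x w)) => [x y|]; first exact: pair_opD.
by rewrite /pair_op !rep_op0.
Qed.

(** Two representations are compared inside the product of their spaces: an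
    intertwiner is an invariant subspace of pairs, and it is isometric when the
    difference of the two inner products vanishes on it. *)
Definition same_dot (w w' : pi1 * pi2) : Prop :=
  hdot w.1 w'.1 = hdot w.2 w'.2.

Lemma same_dotC w w' : same_dot w w' -> same_dot w' w.
Proof. by rewrite /same_dot hdotC => h; rewrite [RHS]hdotC -h conjCK. Qed.

Lemma same_dot_star x w w' :
  same_dot (pair_op (star x) w) w' -> same_dot w (pair_op x w').
Proof. by rewrite /same_dot /= !rep_op_star. Qed.

Lemma same_dot_subspace w' : closed_subspace [set w | same_dot w w'].
Proof.
split => [||u v|a u]; rewrite /same_dot /=.
- have -> : [set w : pi1 * pi2 | hdot w.1 w'.1 = hdot w.2 w'.2] =
      (fun w => hdot w.1 w'.1 - hdot w.2 w'.2) @^-1` [set 0].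
    by apply/seteqP; split => w /= => [->|/subr0_eq//]; rewrite subrr.
  apply: preimage_closed; last first.
    apply/accessible_closed_set1/hausdorff_accessible.
    exact: (@norm_hausdorff R[i] R[i]^o).
  move=> w _; apply: cvgB.
    apply: (cvg_comp fst (fun u => hdot u w'.1)); first exact: cvg_fst.
    exact: hdot_continuous_l.
  apply: (cvg_comp snd (fun u => hdot u w'.2)); first exact: cvg_snd.
  exact: hdot_continuous_l.
- by rewrite !hdot0l.
- by rewrite !hdotDl => -> ->.
- by rewrite !hdotZl => ->.
Qed.

End pair_action.

(** * The Cuntz-Krieger relations in a representation *)

Section cuntz_krieger_relations.
Variables (R : realType) (N : nat) (A : 'M[bool]_N).
Variables (O : cstarAlgType R[i]) (s : 'I_N -> O).
Hypothesis hs : cuntz_krieger_family A s.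
Variable pi : representation O.
Implicit Types (u v w : pi).

(** With v = s_j w, the sum of the |s_k* v|^2 over all k is |v|^2, and the term
    k = j already equals |v|^2 because s_j is a partial isometry.  The other
    terms, being nonnegative, vanish. *)
Lemma ck_orthogonal i j w :
  i != j -> rep_op pi (star (s i)) (rep_op pi (s j) w) = 0.
Proof.
move=> ij; have [pis _ s1] := hs; pose v := rep_op pi (s j) w.
have rn k : hdot (rep_op pi (star (s k)) v) (rep_op pi (star (s k)) v) =
    hdot (rep_op pi (s k * star (s k)) v) v.
  by rewrite rep_opM [RHS]rep_op_starr.
have vj : rep_op pi (s j * star (s j)) v = v by rewrite /v -rep_opM pis.
have := hdot_suml (fun k => rep_op pi (s k * star (s k)) v) v.
rewrite -rep_op_sum s1 rep_op1 (bigD1 j)//= vj => /eqP.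
rewrite -subr_eq0 opprD addrA subrr sub0r oppr_eq0.
under eq_bigr do rewrite -rn.
rewrite psumr_eq0 => [|k _]; last exact: hdot_ge0.
by move=> /allP/(_ i (mem_index_enum _)); rewrite ij hdot_eq0 => /eqP.
Qed.

(** s_i* s_i is a projection, and a projection fixes the vectors whose norm it
    preserves. *)
Lemma ck_source_isometric i w :
  `|rep_op pi (s i) w| = `|w| -> rep_op pi (star (s i)) (rep_op pi (s i) w) = w.
Proof.
move=> nw; have [pis _ _] := hs.
have e1 : hdot (rep_op pi (s i) w) (rep_op pi (s i) w) = hdot w w.
  by rewrite !hdot_norm nw.
set p := rep_op pi (star (s i)) _.
have dp v : hdot p v = hdot (rep_op pi (s i) w) (rep_op pi (s i) v).
  by rewrite rep_op_star.
have sp : rep_op pi (s i) p = rep_op pi (s i) w by rewrite -!rep_opM pis.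
have wp : hdot w p = hdot w w by rewrite hdotC dp e1 -hdotC.
apply/eqP; rewrite -subr_eq0 -hdot_eq0 hdotBl !hdotBr !dp sp wp e1.
by rewrite !subrr.
Qed.

End cuntz_krieger_relations.

(** * Unitary equivalence from a coinvariant set of vectors *)

Section coinvariant_uniqueness.
Variables (R : realType) (N : nat) (A : 'M[bool]_N).
Variables (O : cstarAlgType R[i]) (s : 'I_N -> O).
Hypothesis hs : cuntz_krieger_family A s.
Hypothesis hgen : cstar_generated s.
Variables (pi1 pi2 : representation O) (V : set (pi1 * pi2)).
Hypothesis V_coinvariant : forall i w, V w -> V (pair_op (star (s i)) w).
Hypothesis V_same_dot : forall w w', V w -> V w' -> same_dot w w'.

Let word I : O := \prod_(i <- I) s i.

Definition word_orbit : set (pi1 * pi2) :=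
  [set w | exists I v, V v /\ w = pair_op (word I) v].

Definition coinvariant_hull : set (pi1 * pi2) := closed_span word_orbit.

Let W := coinvariant_hull.

Let W_subspace : closed_subspace W.
Proof. exact: closed_span_closed_subspace. Qed.

Lemma coinvariant_hull_stable_of x :
  (forall w, word_orbit w -> W (pair_op x w)) ->
  forall w, W w -> W (pair_op x w).
Proof.
move=> xW w Ww; apply: (Ww (pair_op x @^-1` W)) => //.
apply: closed_subspace_preimage W_subspace; exact: pair_op_continuous.
Qed.

Lemma coinvariant_hull_gen i w : W w -> W (pair_op (s i) w).
Proof.
apply: coinvariant_hull_stable_of => _ [I [v [Vv ->]]].
apply: closed_span_sub; exists (i :: I), v; split => //.
by rewrite -pair_opM /word big_cons.
Qed.

(** An adjoint s_i* meets the first letter j of a word: the product is 0 if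
    i <> j, and otherwise s_i* s_i is a combination of the s_k s_k*, whose
    adjoints meet a shorter word.  On the empty word, V is coinvariant. *)
Lemma coinvariant_hull_star_gen i w : W w -> W (pair_op (star (s i)) w).
Proof.
apply: coinvariant_hull_stable_of => _ [I [v [Vv ->]]].
elim: I i => [|j I IH] i.
  rewrite /word big_nil pair_op1; apply: closed_span_sub.
  exists [::], (pair_op (star (s i)) v); split; first exact: V_coinvariant.
  by rewrite /word big_nil pair_op1.
rewrite /word big_cons -/(word I) pair_opM.
have [->|ij] := eqVneq i j; last first.
  rewrite {1}/pair_op /= !(ck_orthogonal hs)//.
  by case: W_subspace.
have [_ _ WA WZ] := W_subspace; have [_ ss _] := hs.
rewrite -pair_opM ss pair_op_sum; apply: closed_subspace_sum => // k.
rewrite pair_opZ pair_opM; apply: WZ; apply: coinvariant_hull_gen; exact: IH.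
Qed.

(** The elements x for which both x and x* preserve the hull form a closed
    *-subalgebra containing the generators. *)
Lemma coinvariant_hull_invariant x w : W w -> W (pair_op x w).
Proof.
pose D : set O :=
  [set x | forall w, W w -> W (pair_op x w) /\ W (pair_op (star x) w)].
have [Wc W0 WA WZ] := W_subspace.
suff DT : D = setT.
  by move=> Ww; have : D x by [rewrite DT]; move=> /(_ w Ww)[].
apply: hgen => {w}
  [|i w Ww|y z Dy Dz w Ww|a y Dy w Ww|y z Dy Dz w Ww|y Dy w Ww].
- move=> y cy w Ww; split.
    have : closed ((fun x => pair_op x w) @^-1` W).
      by apply: preimage_closed => // z _; exact: pair_op_continuous_l.
    by apply; apply: closure_subset cy => z /(_ w Ww)[].
  have : closed ((fun x => pair_op (star x) w) @^-1` W).
    apply: preimage_closed => // z _.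
    apply: (cvg_comp star (fun x => pair_op x w)); first exact: star_continuous.
    exact: pair_op_continuous_l.
  by apply; apply: closure_subset cy => z /(_ w Ww)[].
- by split; [exact: coinvariant_hull_gen|exact: coinvariant_hull_star_gen].
- have [? ?] := Dy _ Ww; have [? ?] := Dz _ Ww.
  by rewrite starD !pair_opD; split; exact: WA.
- by have [? ?] := Dy _ Ww; rewrite starZ !pair_opZ; split; exact: WZ.
- rewrite cstar_starM !pair_opM; split.
    by apply: (Dy _ _).1; apply: (Dz _ _).1.
  by apply: (Dz _ _).2; apply: (Dy _ _).2.
- by have [? ?] := Dy _ Ww; rewrite starK.
Qed.

(** A word on the left of an inner product moves to the right as an adjoint,
    which V absorbs; a word on the right moves to the left as an adjoint, which
    the hull absorbs. *)
Lemma coinvariant_hull_same_dot w w' : W w -> W w' -> same_dot w w'.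
Proof.
have V_word I v : V v -> V (pair_op (star (word I)) v).
  elim: I v => [|i I IH] v Vv; first by rewrite /word big_nil star1 pair_op1.
  rewrite /word big_cons cstar_starM pair_opM.
  by apply: IH; exact: V_coinvariant.
have WV u v : W u -> V v -> same_dot u v.
  move=> Wu Vv; apply: (Wu [set u | same_dot u v]).
    exact: same_dot_subspace.
  move=> _ [I [v' [Vv' ->]]]; apply/same_dotC/same_dot_star.
  by apply: V_same_dot => //; exact: V_word.
move=> Ww Ww'; apply: same_dotC; apply: (Ww' [set u | same_dot u w]).
  exact: same_dot_subspace.
move=> _ [I [v [Vv ->]]]; apply/same_dotC/same_dot_star.
by apply: WV => //; exact: coinvariant_hull_invariant.
Qed.

(** The hull contains the orbit of (Omega1, Omega2), so both of its projections
    are dense: it is the graph of a surjective isometry. *)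
Lemma coinvariant_unitarily_equivalent (Omega1 : pi1) (Omega2 : pi2) :
  V (Omega1, Omega2) -> cyclic_vector Omega1 -> cyclic_vector Omega2 ->
  unitarily_equivalent pi1 pi2.
Proof.
move=> VO c1 c2.
have WO x : W (pair_op x (Omega1, Omega2)).
  apply: coinvariant_hull_invariant; apply: closed_span_sub.
  exists [::], (Omega1, Omega2); split => //.
  by rewrite /word big_nil pair_op1.
have Wnorm w : W w -> `|w.1| = `|w.2|.
  move=> Ww; apply/eqP; rewrite -(@eqrXn2 _ 2)// -!hdot_norm; apply/eqP.
  exact: coinvariant_hull_same_dot.
have [_ _ WA WZ] := W_subspace.
have /choice[U WU] : forall u, exists v, W (u, v).
  exact: (isometric_graph_total W_subspace Wnorm WO).
have fun_W := isometric_graph_functional W_subspace Wnorm.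
have U_linear : linear U.
  move=> a u v; apply: (fun_W _ _ _ (WU _)).
  by apply: (WA (_, _) (_, _)) => //; exact: (WZ a (_, _)).
have surj_W v : exists u, W (u, v).
  pose swap (w : pi2 * pi1) : pi1 * pi2 := (w.2, w.1).
  have swap_linear : linear swap by [].
  pose swapL : {linear _ -> _} :=
    HB.pack swap (GRing.isLinear.Build _ _ _ _ _ swap_linear).
  have W'_subspace : closed_subspace (swapL @^-1` W).
    apply: closed_subspace_preimage => // w.
    by apply: cvg_pair; [exact: cvg_snd|exact: cvg_fst].
  by apply: (isometric_graph_total W'_subspace _
    (f := fun x => rep_op pi2 x Omega2)
    (g := fun x => rep_op pi1 x Omega1)) => // w /= /Wnorm.
pose UL : {linear pi1 -> pi2} :=
  HB.pack U (GRing.isLinear.Build _ _ _ _ _ U_linear).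
exists UL; split=> [u v|v|x u].
- exact/esym/(coinvariant_hull_same_dot (WU u) (WU v)).
- have [u Wuv] := surj_W v; exists u.
  exact: (fun_W _ _ _ (WU u)).
- by apply: (fun_W _ _ _ (WU _)); exact: (coinvariant_hull_invariant x (WU u)).
Qed.

End coinvariant_uniqueness.

(** * Cycle representations *)

Section cycle_vectors.
Variables (R : realType) (N : nat) (A : 'M[bool]_N).
Variables (O : cstarAlgType R[i]) (s : 'I_N -> O).

Lemma word_op_nil (pi : representation O) (u : pi) : word_op s [::] u = u.
Proof. by rewrite /word_op big_nil rep_op1. Qed.

Lemma word_op_cons (pi : representation O) j J (u : pi) :
  word_op s (j :: J) u = rep_op pi (s j) (word_op s J u).
Proof. by rewrite /word_op big_cons rep_opM. Qed.

Lemma word_op_cat (pi : representation O) J K (u : pi) :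
  word_op s (J ++ K) u = word_op s J (word_op s K u).
Proof. by rewrite /word_op big_cat rep_opM. Qed.

Lemma word_opZ (pi : representation O) J (a : R[i]) (u : pi) :
  word_op s J (a *: u) = a *: word_op s J u.
Proof. by rewrite /word_op linearZ. Qed.

Hypothesis hs : cuntz_krieger_family A s.
Variables (J : seq 'I_N) (z : R[i]).

(** [is_P J z] asks for a vector that has this property and is cyclic; the two
    parts are established by different arguments. *)
Definition cycle_vector (pi : representation O) (Omega : pi) : Prop :=
  [/\ `|Omega| = 1, word_op s J Omega = z *: Omega &
      forall l m, (l < size J)%N -> (m < size J)%N ->
        hdot (word_op s (drop l J) Omega) (word_op s (drop m J) Omega) =
        (l == m)%:R].

Hypothesis J_gt0 : (0 < size J)%N.

Section one.
Variables (pi : representation O) (Omega : pi).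
Hypothesis hOmega : cycle_vector Omega.

Let e l := word_op s (drop l J) Omega.

Lemma cycle_vector_norm l : (l <= size J)%N -> `|e l| = 1.
Proof.
have [O1 _ od] := hOmega; rewrite leq_eqVlt => /predU1P[->|lJ].
  by rewrite /e drop_size word_op_nil.
by apply/eqP; rewrite -(@eqrXn2 _ 2)// -hdot_norm /e od// eqxx expr1n.
Qed.

Lemma cycle_eigenvalue_norm : `|z| = 1.
Proof.
have [O1 Jz _] := hOmega; have := cycle_vector_norm (leq0n _).
by rewrite /e drop0 Jz normrZ O1 mulr1.
Qed.

(** Going once around the cycle multiplies by z, so Omega, the vector for the
    empty suffix, is a multiple of the vector for the whole word. *)
Lemma cycle_vector_first : Omega = z^-1 *: e 0.
Proof.
have [_ Jz _] := hOmega; rewrite /e drop0 Jz scalerK//.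
by rewrite -normr_eq0 cycle_eigenvalue_norm oner_neq0.
Qed.

(** The l-th vector is s_j applied to the next one, with j the l-th letter, and
    s_j preserves its norm. *)
Lemma cycle_vector_star i l : (l < size J)%N ->
  rep_op pi (star (s i)) (e l) = (i == nth i J l)%:R *: e l.+1.
Proof.
move=> lJ; have el : e l = rep_op pi (s (nth i J l)) (e l.+1).
  by rewrite /e (drop_nth i lJ) word_op_cons.
have [->|ij] := eqVneq i (nth i J l); last first.
  by rewrite scale0r el (ck_orthogonal hs).
rewrite scale1r el; apply: (ck_source_isometric hs).
by rewrite -el cycle_vector_norm ?(ltnW lJ)// cycle_vector_norm.
Qed.

End one.

(** The pairs (a e_l, a e'_l) of proportional cycle vectors form a coinvariant
    set: adjoints of generators act on both cycles by the same rule. *)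
Lemma cycle_vector_unique (pi1 pi2 : representation O)
    (Omega1 : pi1) (Omega2 : pi2) :
  cstar_generated s ->
  cycle_vector Omega1 -> cyclic_vector Omega1 ->
  cycle_vector Omega2 -> cyclic_vector Omega2 ->
  unitarily_equivalent pi1 pi2.
Proof.
move=> hgen h1 c1 h2 c2.
pose e1 l := word_op s (drop l J) Omega1.
pose e2 l := word_op s (drop l J) Omega2.
pose V : set (pi1 * pi2) :=
  [set w | exists a l, (l < size J)%N /\ w = (a *: e1 l, a *: e2 l)].
apply: (coinvariant_unitarily_equivalent (V := V) hs hgen _ _ _ c1 c2).
- move=> i _ [a [l [lJ ->]]]; rewrite /pair_op /= !linearZ /=.
  rewrite (cycle_vector_star h1 _ lJ) (cycle_vector_star h2 _ lJ) !scalerA.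
  case: (ltngtP l.+1 (size J)) => [l1J||lk]; last 2 first.
  + by rewrite ltnNge lJ.
  (* After the last letter the cycle closes up, at the cost of a factor z^-1. *)
  + exists (a * (i == nth i J l)%:R * z^-1), 0%N; split => //.
    rewrite -!scalerA -(cycle_vector_first h1) -(cycle_vector_first h2).
    by rewrite lk drop_size !word_op_nil.
  + by exists (a * (i == nth i J l)%:R), l.+1.
- move=> _ _ [a [l [lJ ->]]] [b [m [mJ ->]]]; rewrite /same_dot /=.
  have [_ _ o1] := h1; have [_ _ o2] := h2.
  by rewrite !hdotZl !hdotZr o1// o2.
- exists z^-1, 0%N; split => //.
  by rewrite -(cycle_vector_first h1) -(cycle_vector_first h2).
Qed.

End cycle_vectors.

Lemma is_P_unitary (R : realType) (N : nat) (O : cstarAlgType R[i])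
    (s : 'I_N -> O) J z (pi1 pi2 : representation O) :
  unitarily_equivalent pi1 pi2 -> is_P s J z pi2 -> is_P s J z pi1.
Proof.
move=> [U [Udot Usurj Uop]] [Omega2 [n2 c2 J2 o2]].
have [Omega1 e] := Usurj Omega2.
have Unorm u : `|U u| = `|u|.
  by apply/eqP; rewrite -(@eqrXn2 _ 2)// -!hdot_norm Udot.
have Uinj u v : U u = U v -> u = v.
  move=> uv; apply/eqP; rewrite -subr_eq0 -normr_eq0 -Unorm linearB uv.
  by rewrite subrr normr0.
have Uword K : U (word_op s K Omega1) = word_op s K Omega2.
  by rewrite /word_op Uop e.
exists Omega1; split.
- by rewrite -Unorm e.
- apply/seteqP; split => // u _ B /nbhs_ballP[d /= d0 dB].
  have : closure (range (fun x => rep_op pi2 x Omega2)) (U u) by rewrite c2.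
  move=> /(_ _ (nbhsx_ballx _ _ d0)) [_ [[x _ <-]]].
  rewrite -ball_normE /= => h.
  exists (rep_op pi1 x Omega1); split; first by exists x.
  by apply: dB; rewrite -ball_normE /= -Unorm linearB Uop e.
- by apply: Uinj; rewrite Uword linearZ J2 /= e.
- by move=> l m lJ mJ; rewrite -Udot !Uword o2.
Qed.

(** * Roots of unity *)

Section roots_of_unity.
Variable R : realType.

Lemma unity_root_exp p n : unity_root R p ^+ n =
  (cos (n%:R * (2 * pi / p%:R)) +i* sin (n%:R * (2 * pi / p%:R)))%C.
Proof.
elim: n => [|n IH]; first by rewrite expr0 mul0r cos0 sin0.
set t := 2 * pi / p%:R in IH *.
have -> : n.+1%:R * t = t + n%:R * t.
  by rewrite -[n.+1%:R]natr1 mulrDl mul1r addrC.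
rewrite exprS IH /unity_root -/t cosD sinD.
by apply/eqP; rewrite eq_complex /= eqxx /= addrC.
Qed.

(** For 0 < k < p the angle x = 2 pi k / p satisfies 0 < x / 2 < pi, whence
    cos x = 1 - 2 sin^2 (x / 2) < 1. *)
Lemma unity_root_primitive p : (0 < p)%N -> p.-primitive_root (unity_root R p).
Proof.
move=> p0; have p0' : (0 : R) < p%:R by rewrite ltr0n.
apply/andP; split => //; apply/forallP => k; apply/eqP.
rewrite unity_rootE unity_root_exp.
have [->|kp] := eqVneq k.+1 p.
  rewrite mulrCA divff ?(gt_eqF p0')// mulr1 mulr_natl cos2pi sin2pi.
  by apply/eqP.
set x := _ * _; apply/negbTE/eqP => -[/eqP + _]; apply/negP.
have xE : x / 2 = k.+1%:R / p%:R * pi by rewrite /x; field; rewrite gt_eqF.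
have : 0 < sin (x / 2).
  apply: sin_gt0_pi; rewrite xE mulr_gt0 ?divr_gt0 ?pi_gt0 ?ltr0n//=.
  rewrite gtr_pMl ?pi_gt0// ltr_pdivrMr// mul1r ltr_nat.
  by rewrite ltn_neqAle kp ltn_ord.
rewrite [X in cos X](_ : x = (x / 2) *+ 2); last first.
  by rewrite -[RHS]mulr_natr divfK ?pnatr_eq0.
rewrite cos_mulr2n cos2sin2 => sx; apply/eqP => h.
have : sin (x / 2) ^+ 2 = 0 by move: h; lra.
by apply/eqP; rewrite sqrf_eq0 gt_eqF.
Qed.

Lemma sum_unity_powers (F : fieldType) (q : F) p :
  q ^+ p = 1 -> \sum_(m < p) q ^+ m = if q == 1 then p%:R else 0.
Proof.
move=> qp; have [->|q1] := eqVneq q 1.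
  by under eq_bigr do rewrite expr1n; rewrite sumr_const card_ord.
have := subrX1 q p; rewrite qp subrr => /esym/eqP.
by rewrite mulf_eq0 subr_eq0 (negbTE q1) => /eqP.
Qed.

Lemma norm1_expr (C : numDomainType) (x : C) p :
  (0 < p)%N -> `|x ^+ p| = 1 -> `|x| = 1.
Proof.
by move=> p0 /eqP; rewrite normrX pexpr_eq1// => /eqP.
Qed.

Lemma mul_conj_eq1 (C : numClosedFieldType) (x y : C) :
  `|y| = 1 -> (x * y^* == 1) = (x == y).
Proof.
move=> y1; have yy : y * y^* = 1 by rewrite -normCK y1 expr1n.
have y0 : y^* != 0.
  by apply: contra_eq_neq yy => ->; rewrite mulr0 eq_sym oner_neq0.
by rewrite -yy (inj_eq (mulIf y0)).
Qed.

Variables (p : nat) (p_gt0 : (0 < p)%N) (r : R[i]).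
Hypothesis norm_r : `|r| = 1.

Let w := unity_root R p.
Let z (i : 'I_p) := r * w ^+ i.+1.

Let w_norm : `|w| = 1.
Proof.
apply: (norm1_expr p_gt0).
by rewrite (prim_expr_order (unity_root_primitive p_gt0)) normr1.
Qed.

Lemma twisted_root_norm i : `|z i| = 1.
Proof. by rewrite /z normrM normrX norm_r w_norm expr1n mulr1. Qed.

Lemma twisted_root_exp i : z i ^+ p = r ^+ p.
Proof.
rewrite exprMn exprAC (prim_expr_order (unity_root_primitive p_gt0)).
by rewrite expr1n mulr1.
Qed.

(** The two orthogonality relations for the matrix of the z_i ^ n, by rows and
    by columns.  Up to a factor of modulus 1, both are geometric sums of a p-th
    root of unity q, and q = 1 only on the diagonal. *)
Lemma sum_twisted_root_power n m : (n < p)%N -> (m < p)%N ->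
  \sum_i z i ^+ n * (z i ^+ m)^* = if n == m then p%:R else 0.
Proof.
move=> np mp; pose q := w ^+ n * (w ^+ m)^*.
have prim := unity_root_primitive p_gt0.
have qp : q ^+ p = 1.
  have wp k : (w ^+ k) ^+ p = 1.
    by rewrite exprAC (prim_expr_order prim) expr1n.
  by rewrite exprMn -rmorphXn /= !wp rmorph1 mulr1.
have q1 : (q == 1) = (n == m).
  rewrite mul_conj_eq1 ?normrX ?w_norm ?expr1n//.
  by rewrite (eq_prim_root_expr prim) !modn_small.
have -> : \sum_i z i ^+ n * (z i ^+ m)^* =
    r ^+ n * (r ^+ m)^* * q * \sum_(i < p) q ^+ i.
  rewrite mulr_sumr; apply: eq_bigr => i _.
  rewrite -mulrA -exprS /z /q !exprMn -rmorphXn /= rmorphM /=.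
  by rewrite [w ^+ _ ^+ n]exprAC [w ^+ _ ^+ m]exprAC mulrACA.
rewrite sum_unity_powers// q1.
case: (eqVneq n m) => [nm|]; last by rewrite mulr0.
move: q1; rewrite nm eqxx => /eqP ->.
by rewrite -normCK normrX norm_r !expr1n !mul1r.
Qed.

Lemma sum_power_twisted_root i j :
  \sum_(m < p) z i ^+ m * (z j ^+ m)^* = if i == j then p%:R else 0.
Proof.
have prim := unity_root_primitive p_gt0.
have -> : \sum_(m < p) z i ^+ m * (z j ^+ m)^* =
    \sum_(m < p) (z i * (z j)^*) ^+ m.
  by apply: eq_bigr => m _; rewrite rmorphXn /= [RHS]exprMn.
rewrite sum_unity_powers.
  have r0 : r != 0 by rewrite -normr_eq0 norm_r oner_neq0.
  rewrite mul_conj_eq1 ?twisted_root_norm// (inj_eq (mulfI r0)).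
  rewrite (eq_prim_root_expr prim) -(addn1 i) -(addn1 j) eqn_modDr.
  by rewrite !modn_small.
by rewrite exprMn -rmorphXn /= !twisted_root_exp -normCK normrX norm_r !expr1n.
Qed.

End roots_of_unity.

(** * Powers of a cycle *)

Lemma size_word_power N (J : seq 'I_N) p :
  size (word_power J p) = (p * size J)%N.
Proof. by elim: p => //= p IH; rewrite size_cat IH. Qed.

(** The power is p.-1 - l %/ size J because one of the p copies of J, that in which
    the cut falls, contributes only a suffix. *)
Lemma drop_word_power N (J : seq 'I_N) p l : (l < p * size J)%N ->
  drop l (word_power J p) =
  drop (l %% size J) J ++ word_power J (p.-1 - l %/ size J).
Proof.
elim: p l => // p IH l lp.
have J0 : (0 < size J)%N by case: (size J) lp; rewrite ?muln0.
rewrite drop_cat; case: ltnP => [lJ|Jl].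
  by rewrite modn_small// divn_small// subn0.
have lE : (l = l - size J + size J)%N by rewrite subnK.
rewrite IH; last by rewrite ltn_subLR// -mulSn.
rewrite [in RHS]lE modnDr divnDr ?dvdnn// divnn J0 addn1.
by case: p {IH} lp => // p; rewrite mul1n ltnNge Jl.
Qed.

Lemma hilbert_sum_sumE (C : numClosedFieldType) (I J : finType)
    (H : I -> hilbertType C) (F : J -> hilbert_sum H) i :
  (\sum_j F j) i = \sum_j F j i.
Proof.
exact: (big_morph (fun u : hilbert_sum H => u i)
  (fun u v => hilbert_sumDE u v i) (erefl : (0 : hilbert_sum H) i = 0)).
Qed.

Section cycle_power.
Variables (R : realType) (N : nat) (O : cstarAlgType R[i]) (s : 'I_N -> O).
Variables (J : seq 'I_N) (p : nat) (r : R[i]).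
Hypotheses (J_gt0 : (0 < size J)%N) (p_gt0 : (0 < p)%N) (norm_r : `|r| = 1).
Variable sigma : 'I_p -> representation O.

Let z (i : 'I_p) := r * unity_root R p ^+ i.+1.

Variable om : forall i, sigma i.
Hypothesis om_cycle : forall i, cycle_vector s J (z i) (om i).
Hypothesis om_cyclic : forall i, cyclic_vector (om i).

Let k : R[i] := (sqrtC p%:R)^-1.

Let kk : k * k^* = p%:R^-1.
Proof.
by rewrite -normCK normfV exprVn ger0_norm ?sqrtC_ge0// sqrtCK.
Qed.

Let p_neq0 : p%:R != 0 :> R[i]. Proof. by rewrite pnatr_eq0 -lt0n. Qed.

Definition average_vector : representation_sum sigma :=
  k *: ((fun i => om i) : hilbert_sum sigma).

Let Om := average_vector.

Lemma word_op_sumE K (u : representation_sum sigma) i :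
  word_op s K u i = word_op s K (u i).
Proof. by []. Qed.

Lemma word_op_power n i : word_op s (word_power J n) (om i) = z i ^+ n *: om i.
Proof.
have [_ Jz _] := om_cycle i.
elim: n => [|n IH]; first by rewrite word_op_nil scale1r.
by rewrite /word_power /= word_op_cat IH word_opZ Jz scalerA exprSr.
Qed.

(** Two cut positions l and m that differ by a multiple of size J give, in each
    summand, multiples of the same vector: only the sum over the summands makes
    them orthogonal. *)
Lemma average_vector_cycle : cycle_vector s (word_power J p) (r ^+ p) Om.
Proof.
have dotE (f g : forall i, sigma i) :
    hdot (k *: (f : hilbert_sum sigma)) (k *: (g : hilbert_sum sigma)) =
    p%:R^-1 * \sum_i hdot (f i) (g i).
  by rewrite hdotZl hdotZr mulrA kk.
split.
- apply/eqP; rewrite -(@eqrXn2 _ 2)// -hdot_norm dotE.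
  under eq_bigr => i _.
    have [n1 _ _] := om_cycle i; rewrite hdot_norm n1 expr1n; over.
  by rewrite sumr_const card_ord mulVf// expr1n.
- apply/functional_extensionality_dep => i; rewrite word_op_sumE.
  rewrite [Om i]hilbert_sumZE word_opZ word_op_power twisted_root_exp//.
  by rewrite [RHS]hilbert_sumZE scalerA mulrC -scalerA.
- move=> l m; rewrite size_word_power => lJ mJ.
  have wE n : (n < p * size J)%N -> word_op s (drop n (word_power J p)) Om =
      k *: ((fun i => z i ^+ (p.-1 - n %/ size J) *:
                   word_op s (drop (n %% size J) J) (om i))
              : hilbert_sum sigma).
    move=> nJ; apply/functional_extensionality_dep => i; rewrite word_op_sumE.
    rewrite drop_word_power// [Om i]hilbert_sumZE word_opZ word_op_cat.
    by rewrite word_op_power word_opZ.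
  rewrite !wE// dotE.
  under eq_bigr => i _.
    have [_ _ o] := om_cycle i.
    rewrite hdotZl hdotZr o ?ltn_mod// mulrA; over.
  rewrite -mulr_suml sum_twisted_root_power//; last 2 first.
  + by rewrite (leq_ltn_trans (leq_subr _ _))// prednK.
  + by rewrite (leq_ltn_trans (leq_subr _ _))// prednK.
  have lp : (l %/ size J <= p.-1)%N by rewrite -ltnS prednK// ltn_divLR.
  have mp : (m %/ size J <= p.-1)%N by rewrite -ltnS prednK// ltn_divLR.
  have -> : (p.-1 - l %/ size J == p.-1 - m %/ size J)%N =
            (l %/ size J == m %/ size J)%N.
    apply/eqP/eqP => [|->//] e.
    by rewrite -(subKn lp) e subKn.
  have -> : (l == m) =
      ((l %/ size J == m %/ size J) && (l %% size J == m %% size J))%N.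
    apply/eqP/andP => [->//|[/eqP d /eqP e]].
    by rewrite (divn_eq l (size J)) d e -divn_eq.
  by case: ifP => _ /=; rewrite ?mul0r ?mulr0// mulrA mulVf// mul1r.
Qed.

(** On the i-th summand the word J multiplies the cyclic vector by z_i, so
    averaging its powers against the conjugates of the z_j ^ m isolates the
    j-th summand.  The scalar compensates the factor k in [average_vector] and
    the p of the orthogonality relation. *)
Lemma average_vector_component j : exists q : O,
  forall i, rep_op (representation_sum sigma) q Om i =
            (i == j)%:R *: om i.
Proof.
exists ((k * p%:R)^-1 *:
  \sum_(m < p) (z j ^+ m)^* *: \prod_(a <- word_power J m) s a).
move=> i; rewrite rep_opZ rep_op_sum [LHS]hilbert_sumZE.
have k0 : k != 0 by rewrite invr_eq0 sqrtC_eq0.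
rewrite hilbert_sum_sumE.
under eq_bigr => m _.
  rewrite rep_opZ hilbert_sumZE.
  rewrite -[rep_op _ _ _]/(word_op s (word_power J m) Om) word_op_sumE.
  rewrite [Om i]hilbert_sumZE word_opZ word_op_power !scalerA mulrAC.
  rewrite [_ * z i ^+ _]mulrC.
  over.
rewrite -scaler_suml -mulr_suml sum_power_twisted_root// scalerA.
case: eqP => _; last by rewrite mul0r mulr0.
by rewrite mulrC [_ * k]mulrC mulfV// mulf_neq0.
Qed.

(** If x_j carries the j-th cyclic vector close to u_j and q_j is the element
    given by [average_vector_component], then the sum of the x_j q_j carries the
    average vector close to u. *)
Lemma average_vector_cyclic : cyclic_vector Om.
Proof.
have [q qE] := choice average_vector_component.
apply/seteqP; split => // u _ B /nbhs_ballP[e /= e0 eB].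
have d0 : 0 < e / (#|'I_p|.+1)%:R by rewrite divr_gt0.
have /choice[x xE] : forall i, exists x : O,
    `|u i - rep_op (sigma i) x (om i)| < e / (#|'I_p|.+1)%:R.
  move=> i; have : closure (range (fun x => rep_op (sigma i) x (om i))) (u i).
    by rewrite (om_cyclic i).
  move=> /(_ _ (nbhsx_ballx _ _ d0)) [_ [[x _ <-]]].
  rewrite -ball_normE /= => h.
  by exists x.
pose v := rep_op (representation_sum sigma) (\sum_j x j * q j) Om.
have vE i : v i = rep_op (sigma i) (x i) (om i).
  have xqE j : rep_op (representation_sum sigma) (x j * q j) Om i =
      (i == j)%:R *: rep_op (sigma i) (x j) (om i).
    by rewrite rep_opM -linearZ -qE.
  rewrite /v rep_op_sum hilbert_sum_sumE (bigD1 i)//= xqE eqxx scale1r.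
  by rewrite big1 ?addr0// => j ji; rewrite xqE eq_sym (negbTE ji) scale0r.
exists v; split; first by exists (\sum_j x j * q j).
apply: eB; rewrite -ball_normE /=.
apply: (@le_lt_trans _ _ (e / (#|'I_p|.+1)%:R * #|'I_p|%:R)).
  apply: hilbert_sum_norm_le => [|i]; first exact: ltW.
  by rewrite hilbert_sumDE hilbert_sumNE vE; exact/ltW/xE.
by rewrite mulrAC ltr_pdivrMr// ltr_pM2l// ltr_nat.
Qed.

Lemma is_P_sum : is_P s (word_power J p) (r ^+ p) (representation_sum sigma).
Proof.
have [n w o] := average_vector_cycle.
by exists Om; split => //; exact: average_vector_cyclic.
Qed.

End cycle_power.

(** One direction is transport of structure from the sum, which is itself
    P(J^p; r^p); the other is uniqueness of P(J^p; r^p). *)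
Lemma is_P_power_iff (R : realType) (N : nat) (A : 'M[bool]_N)
    (O : cstarAlgType R[i]) (s : 'I_N -> O) (J : seq 'I_N) (p : nat) (r : R[i])
    (sigma : 'I_p -> representation O) (pi : representation O) :
  cuntz_krieger_family A s -> cstar_generated s ->
  (0 < size J)%N -> (0 < p)%N -> `|r| = 1 ->
  (forall j : 'I_p, is_P s J (r * unity_root R p ^+ j.+1) (sigma j)) ->
  is_P s (word_power J p) (r ^+ p) pi <->
  unitarily_equivalent pi (representation_sum sigma).
Proof.
move=> hs hgen J0 p0 r1 hsigma.
have om_P i := cid (hsigma i).
pose om i := projT1 (om_P i).
have om_cycle (i : 'I_p) : cycle_vector s J (r * unity_root R p ^+ i.+1) (om i).
  by rewrite /om; case: (om_P i) => Omega [].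
have om_cyclic (i : 'I_p) : cyclic_vector (om i).
  by rewrite /om; case: (om_P i) => Omega [].
have sum_P := is_P_sum J0 p0 r1 om_cycle om_cyclic.
split=> [pi_P|/is_P_unitary]; last exact.
have Jp0 : (0 < size (word_power J p))%N by rewrite size_word_power muln_gt0 p0.
have [Omega [n1 c1 w1 o1]] := pi_P; have [Omega' [n2 c2 w2 o2]] := sum_P.
by apply: (cycle_vector_unique (z := r ^+ p) hs Jp0 hgen _ c1 _ c2); split.
Qed.

Theorem proposition5p1 (R : realType) (N : nat) (hN : (2 <= N)%N)
    (A : 'M[bool]_N) (hA : nondegenerate_mx A)
    (O : cstarAlgType R[i]) (s : 'I_N -> O)
    (hO : is_cuntz_krieger_algebra A s)
    (J : seq 'I_N) (hJ : cyclic_word A J)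
    (c : R[i]) (hc : `|c| = 1) (p : nat) (hp : (1 <= p)%N) :
  (forall r : R[i], r ^+ p = c ->
    forall sigma : 'I_p -> representation O,
      (forall j : 'I_p, is_P s J (r * unity_root R p ^+ j.+1) (sigma j)) ->
    forall pi : representation O,
      is_P s (word_power J p) c pi <->
      unitarily_equivalent pi (representation_sum sigma)) /\
  (forall sigma : 'I_p -> representation O,
      (forall j : 'I_p, is_P s J (unity_root R p ^+ j.+1) (sigma j)) ->
    forall pi : representation O,
      is_P s (word_power J p) 1 pi <->
      unitarily_equivalent pi (representation_sum sigma)).
Proof.
have [hs hgen _] := hO; have [J_neq0 _] := hJ.
have J_gt0 : (0 < size J)%N by case: (J) J_neq0.
split=> [r rp|] sigma hsigma pi.
  rewrite -rp; apply: (is_P_power_iff pi hs hgen) => //.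
  by apply: (norm1_expr hp); rewrite rp.
rewrite -[1](expr1n R[i] p).
apply: (is_P_power_iff pi hs hgen) => // [|j]; first by rewrite normr1.
by rewrite mul1r.
Qed.
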